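(* Let $\Delta$ be a finite reduced root system. The action of $\mathrm{Aut}(\Delta)$ on the variables $\mathbf{s},\mathbf{t},\mathbf{k},\mathbf{y}$, and hence on functions of them, extends to an action of the extended affine Weyl group $\widehat W=\mathrm{Aut}(\Delta)\ltimes\tau(Q^\vee)$ by letting $\tau(q)$ ($q\in Q^\vee$) act by $(\tau(q)\mathbf{s})_\alpha=s_\alpha$, $(\tau(q)\mathbf{t})_\alpha=t_\alpha$, $(\tau(q)\mathbf{k})_\alpha=k_\alpha$, $\tau(q)\mathbf{y}=\mathbf{y}+q$, and for all $q\in Q^\vee$ $$(\tau(q)S)(\mathbf{s},\mathbf{y};\Delta)=S(\mathbf{s},\mathbf{y};\Delta),\quad(\tau(q)F)(\mathbf{t},\mathbf{y};\Delta)=F(\mathbf{t},\mathbf{y};\Delta),\quad(\tau(q)P)(\mathbf{k},\mathbf{y};\Delta)=P(\mathbf{k},\mathbf{y};\Delta)$$ for $\mathbf{s}\in\mathcal{S}$, $\mathbf{t}\in\mathbb{C}^{|\Delta_+|}$ (as meromorphic functions of $\mathbf{t}$), $\mathbf{k}\in\mathbb{Z}_{\ge0}^{|\Delta_+|}$ and $\mathbf{y}\in V$.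
   Context: $V$ is an $r$-dimensional real inner product space, $V^*$ identified with $V$; $\Delta\subset V$ is a finite reduced root system with fundamental system $\Psi=\{\alpha_1,\dots,\alpha_r\}$, positive/negative roots $\Delta_\pm$, coroots $\alpha^\vee$; fundamental weights satisfy $\langle\alpha_i^\vee,\lambda_j\rangle=\delta_{ij}$; $Q^\vee=\bigoplus_i\mathbb{Z}\alpha_i^\vee$, $P=\bigoplus_i\mathbb{Z}\lambda_i$. $\mathrm{Aut}(\Delta)\subset\mathrm{GL}(V)$ is the group of linear automorphisms stabilizing $\Delta$; the inner product is assumed $\mathrm{Aut}(\Delta)$-invariant (automatic when $\Delta$ is irreducible), so $\mathrm{Aut}(\Delta)$ stabilizes $Q^\vee$. $\tau(u):v\mapsto v+u$ is translation on $V$. For $w\in\mathrm{Aut}(\Delta)$, $\Delta_w=\Delta_+\cap w^{-1}\Delta_-$. $\{x\}=x-[x]$; $B_k(x)$ is the $k$-th Bernoulli polynomial. Vectors $\mathbf{s},\mathbf{t},\mathbf{k}$ are indexed by $\Delta/\{\pm1\}$. $\mathrm{Aut}(\Delta)$ acts by $(w\mathbf{s})_\alpha=s_{w^{-1}\alpha}$, $(w\mathbf{k})_\alpha=k_{w^{-1}\alpha}$, and, for $\alpha\in\Delta_+$, $(w\mathbf{t})_\alpha=t_{w^{-1}\alpha}$ if $\alpha\notin\Delta_{w^{-1}}$, $(w\mathbf{t})_\alpha=-t_{w^{-1}\alpha}$ if $\alpha\in\Delta_{w^{-1}}$; and linearly on $\mathbf{y}\in V$. A group element $g$ acts on a function by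 $(gf)(\cdot,\mathbf{y})=f(g^{-1}\cdot,g^{-1}\mathbf{y})$. $\mathcal{S}=\{\mathbf{s}\in\mathbb{C}^{|\Delta_+|}:\Re s_\alpha>1\ \forall\alpha\in\Delta_+\}$; $$S(\mathbf{s},\mathbf{y};\Delta)=\sum_{\lambda\in P,\ \langle\alpha^\vee,\lambda\rangle\ne0\,\forall\alpha\in\Delta}e^{2\pi\sqrt{-1}\langle\mathbf{y},\lambda\rangle}\prod_{\alpha\in\Delta_+}\frac1{\langle\alpha^\vee,\lambda\rangle^{s_\alpha}}$$ (fixed branch for powers of negative reals); $$P(\mathbf{k},\mathbf{y};\Delta)=\int_0^1\!\!\cdots\!\int_0^1\Bigl(\prod_{\alpha\in\Delta_+\setminus\Psi}B_{k_\alpha}(x_\alpha)\Bigr)\biggl(\prod_{i=1}^rB_{k_{\alpha_i}}\Bigl(\Bigl\{\langle\mathbf{y},\lambda_i\rangle-\sum_{\alpha\in\Delta_+\setminus\Psi}x_\alpha\langle\alpha^\vee,\lambda_i\rangle\Bigr\}\Bigr)\biggr)\prod_{\alpha\in\Delta_+\setminus\Psi}dx_\alpha;$$ $$F(\mathbf{t},\mathbf{y};\Delta)=\sum_{\mathbf{k}}P(\mathbf{k},\mathbf{y};\Delta)\prod_{\alpha\in\Delta_+}\frac{t_\alpha^{k_\alpha}}{k_\alpha!}\ (|t_\alpha|<2\pi),$$ continued meromorphically in $\mathbf{t}$ to $\mathbb{C}^{|\Delta_+|}$ for fixed $\mathbf{y}$. *)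

(* Defs.v *)
From HB Require Import structures.
From mathcomp Require Import all_boot all_order all_algebra.
From mathcomp Require Import finmap.
From mathcomp Require Import all_classical all_reals all_analysis.
From mathcomp.analysis.showcase Require Import summability.
From mathcomp Require Import complex.
From mathcomp Require Import ring.

Set Implicit Arguments.
Unset Strict Implicit.
Unset Printing Implicit Defensive.

Import Order.TTheory GRing.Theory Num.Theory.
Import numFieldNormedType.Exports.

Local Open Scope classical_set_scope.
Local Open Scope fset_scope.
Local Open Scope ring_scope.
Local Open Scope complex_scope.

Section RootSystem.
Variables (R : realType) (V : vectType R) (B : {dot V for @idfun R}).
Implicit Types (a b u v : V).

Definition coroot a : V := (2 / B a a) *: a.

Definition reflection a v : V := v - B (coroot a) v *: a.

Definition reduced_root_system (Delta : {fset V}) : Prop :=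
  [/\ 0 \notin Delta,
      <<Delta>>%VS = fullv,
      {in Delta &, forall a b, reflection a b \in Delta},
      {in Delta &, forall a b, B (coroot a) b \is a Num.int} &
      {in Delta, forall a (c : R), c *: a \in Delta -> c = 1 \/ c = -1}].

Definition fundamental_system (Delta : {fset V})
    (Psi : (\dim {:V}).-tuple V) : Prop :=
  [/\ basis_of fullv Psi,
      {subset Psi <= Delta} &
      {in Delta, forall a, (forall i, coord Psi i a \is a Num.nat) \/
                           (forall i, coord Psi i (- a) \is a Num.nat)}].

Definition stabilizes (Delta : {fset V}) (w : 'End(V)) : bool :=
  (lker w == 0%VS) && ([fset w a | a in Delta] == Delta).

End RootSystem.

Record root_datum (R : realType) (V : vectType R) := RootDatum {
  form : {dot V for @idfun R};
  Delta : {fset V};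
  Psi : (\dim {:V}).-tuple V;
  fweight : 'I_(\dim {:V}) -> V;
  root_systemP : reduced_root_system form Delta;
  fundamentalP : fundamental_system Delta Psi;
  fweightP : forall i j, form (coroot form Psi`_i) (fweight j) = (i == j)%:R;
  form_invariant : forall w, stabilizes Delta w ->
    forall u v, form (w u) (w v) = form u v
}.

Section Notions.
Variables (R : realType) (V : vectType R) (D : root_datum V).
Implicit Types (a b u v y : V).

Local Notation r := (\dim {:V}).
Local Notation B := (form D).
Local Notation cr := (coroot (form D)).

Definition pos_root : {fset V} :=
  [fset a in Delta D | [forall i, 0 <= coord (Psi D) i a]].

Definition neg_root : {fset V} := [fset - a | a in pos_root].

Definition coroot_lattice : set V :=
  [set q | exists n : 'I_r -> int, q = \sum_i (n i)%:~R *: cr (Psi D)`_i].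

Definition weight_lattice : set V :=
  [set l | exists n : 'I_r -> int, l = \sum_i (n i)%:~R *: fweight D i].

Definition AutDelta : Type := {w : 'End(V) | stabilizes (Delta D) w}.

Definition Qvee : Type := set_type coroot_lattice.

HB.instance Definition _ := Choice.on AutDelta.
HB.instance Definition _ := Choice.on Qvee.

Lemma formDr u v w : B u (v + w) = B u v + B u w.
Proof. exact: linearDr. Qed.

Lemma formZr c u v : B u (c *: v) = c * B u v.
Proof. by rewrite linearZr. Qed.

Lemma formC u v : B u v = B v u.
Proof. by have /= := hermC (form D) u v; rewrite expr0 mul1r. Qed.

Lemma formZl c u v : B (c *: u) v = c * B u v.
Proof. by rewrite formC formZr formC. Qed.

Lemma form_gt0 u : u != 0 -> 0 < B u u.
Proof. exact: neq0_dnorm_gt0. Qed.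

Lemma root_neq0 a : a \in Delta D -> a != 0.
Proof.
case: (root_systemP D) => h0 _ _ _ _ ha.
by apply: contraNneq h0 => <-.
Qed.

Lemma corootN a : cr (- a) = - cr a.
Proof. by rewrite /coroot linearNl linearNr /= opprK scalerN. Qed.

Lemma corootr a : a \in Delta D -> B (cr a) a = 2.
Proof.
move=> /root_neq0/form_gt0 h; rewrite /coroot formZl divfK //.
by rewrite gt_eqF.
Qed.

Lemma rootN a : a \in Delta D -> - a \in Delta D.
Proof.
move=> ha; case: (root_systemP D) => _ _ h _ _.
have := h a a ha ha; rewrite /reflection corootr //.
by rewrite scaler_nat mulr2n opprD addrA subrr add0r.
Qed.

Lemma root_pos_or_neg a : a \in Delta D ->
  (a \in pos_root) || (- a \in pos_root).
Proof.
move=> ha; case: (fundamentalP D) => _ _ /(_ a ha) [] h; apply/orP.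
  left; rewrite !inE ha /=; apply/forallP => i.
  by apply: natr_ge0; apply: h.
right; rewrite !inE rootN //=; apply/forallP => i.
by apply: natr_ge0; apply: h.
Qed.

Lemma coroot_base (i : 'I_r) : coroot_lattice (cr (Psi D)`_i).
Proof.
exists (fun j : 'I_r => (j == i)%:Z); rewrite (bigD1 i) //= eqxx scale1r big1 ?addr0 //.
by move=> j /negPf->; rewrite scale0r.
Qed.

Lemma coroot_lattice0 : coroot_lattice 0.
Proof. by exists (fun=> 0); rewrite big1 // => i _; rewrite scale0r. Qed.

Lemma coroot_latticeD p q :
  coroot_lattice p -> coroot_lattice q -> coroot_lattice (p + q).
Proof.
move=> [m ->] [n ->]; exists (fun i => m i + n i).
by rewrite -big_split; apply: eq_bigr => i _; rewrite rmorphD scalerDl.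
Qed.

Lemma coroot_latticeZ (z : int) q :
  coroot_lattice q -> coroot_lattice (z%:~R *: q).
Proof.
move=> [n ->]; exists (fun i => z * n i).
by rewrite scaler_sumr; apply: eq_bigr => i _; rewrite rmorphM scalerA.
Qed.

Lemma coroot_latticeN q : coroot_lattice q -> coroot_lattice (- q).
Proof. by move=> /(coroot_latticeZ (-1)); rewrite mulrN1z scaleN1r. Qed.

Lemma base_in_root (i : 'I_r) : (Psi D)`_i \in Delta D.
Proof.
by case: (fundamentalP D) => _ h _; apply: h; rewrite mem_nth // size_tuple.
Qed.

Lemma base_free : free (Psi D).
Proof. by case: (fundamentalP D) => /basis_free. Qed.

Lemma coord_baseE (i j : 'I_r) : coord (Psi D) i (Psi D)`_j = (i == j)%:R.
Proof. by rewrite coord_free ?base_free // eq_sym. Qed.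

Lemma base_in_pos_root (i : 'I_r) : (Psi D)`_i \in pos_root.
Proof.
rewrite !inE base_in_root; apply/forallP => j.
by rewrite coord_baseE ler0n.
Qed.

Lemma sum_coord_base v : v = \sum_i coord (Psi D) i v *: (Psi D)`_i.
Proof.
case: (fundamentalP D) => /andP[/eqP hs _] _ _.
by apply: coord_span; rewrite hs memvf.
Qed.

Lemma pos_root_natP a : a \in pos_root ->
  forall i, coord (Psi D) i a \is a Num.nat.
Proof.
rewrite !inE => /andP[ha /forallP hp].
case: (fundamentalP D) => _ _ /(_ a ha) [] // h i.
have := h i; rewrite linearN /= => /natr_ge0; rewrite oppr_ge0 => h0.
by have /eqP -> : coord (Psi D) i a == 0; rewrite ?eq_le ?h0 ?hp.
Qed.

Lemma form_reflection a b : a != 0 ->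
  B (reflection B a b) (reflection B a b) = B b b.
Proof.
move=> /form_gt0 ha; rewrite /reflection /coroot -scaleNr formZl.
rewrite !(formDr, formZr) [B (_ + _) b]formC [B (_ + _) a]formC.
rewrite !(formDr, formZr) [B b a]formC; field.
by rewrite gt_eqF.
Qed.

Lemma coroot_reflection a b : a != 0 ->
  cr (reflection B a b) = cr b - B (cr b) a *: cr a.
Proof.
move=> ha; rewrite {1}/coroot form_reflection // /reflection scalerBr.
congr (_ - _); rewrite /coroot !scalerA; congr (_ *: _).
by rewrite !formZl [B b a]formC; ring.
Qed.

Lemma height_ind (P : V -> Prop) :
  (forall a, a \in pos_root ->
     (forall b, b \in pos_root ->
        \sum_i coord (Psi D) i b < \sum_i coord (Psi D) i a -> P b) -> P a) ->
  forall a, a \in pos_root -> P a.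
Proof.
move=> IH a ha.
have hn b : b \in pos_root -> \sum_i coord (Psi D) i b \is a Num.nat.
  by move=> /pos_root_natP hb; apply: rpred_sum.
have [n hN] : exists n : nat, \sum_i coord (Psi D) i a < n%:R.
  have /natrP[n hN] := hn a ha.
  by exists n.+1; rewrite hN ltr_nat.
elim: n a ha hN => [|n IHn] a ha hN.
  by have := natr_ge0 (hn a ha); rewrite leNgt hN.
apply: IH => // b hb hlt; apply: IHn => //.
move: hlt hN; have /natrP[p ->] := hn b hb; have /natrP[q ->] := hn a ha.
by rewrite !ltr_nat => hpq hq; apply: leq_trans hpq _.
Qed.

Lemma pos_rootP a : a \in pos_root -> a \in Delta D.
Proof. by rewrite !inE => /andP[]. Qed.

Lemma coord_pos_ge0 a i : a \in pos_root -> 0 <= coord (Psi D) i a.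
Proof. by rewrite !inE => /andP[_ /forallP]. Qed.

Lemma coroot_pos_lattice a : a \in pos_root -> coroot_lattice (cr a).
Proof.
move: a; apply: height_ind => a hap IH; have ha := pos_rootP hap.
have [i hci hBi] : exists2 i, 0 < coord (Psi D) i a & 0 < B (Psi D)`_i a.
  have : 0 < \sum_i coord (Psi D) i a * B (Psi D)`_i a.
    have := form_gt0 (root_neq0 ha).
    rewrite {2}(sum_coord_base a) linear_sumr /=.
    by under eq_bigr => i _ do rewrite formZr formC.
  rewrite ltNge => /negP hsum.
  apply: contrapT => hno; apply: hsum; apply: sumr_le0 => i _.
  have := coord_pos_ge0 i hap; rewrite le_eqVlt => /predU1P[<-|hc].
    by rewrite mul0r.
  rewrite pmulr_rle0 // leNgt; apply/negP => hb; apply: hno.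
  by exists i.
have hai := base_in_root i.
have [[j /andP[hji hj]]|hno] :=
  pselect (exists j, (j != i) && (coord (Psi D) j a != 0)); last first.
  have ea : a = coord (Psi D) i a *: (Psi D)`_i.
    rewrite {1}(sum_coord_base a) (bigD1 i) //= big1 ?addr0 // => j hj.
    have [->|hj'] := eqVneq (coord (Psi D) j a) 0; first by rewrite scale0r.
    by case: hno; exists j; rewrite hj.
  case: (root_systemP D) => _ _ _ _ hred.
  move: ea; set c := coord _ _ _ => ea.
  have hc : c *: (Psi D)`_i \in Delta D by rewrite -ea.
  have [e|e] := hred _ hai c hc.
    by rewrite ea e scale1r; exact: coroot_base.
  by rewrite ea e scaleN1r corootN; apply/coroot_latticeN/coroot_base.
case: (root_systemP D) => _ _ hrefl hint _.
pose b := reflection B (Psi D)`_i a.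
have hb : b \in Delta D by apply: hrefl.
have cbE k : coord (Psi D) k b =
    coord (Psi D) k a - (k == i)%:R * B (cr (Psi D)`_i) a.
  by rewrite /b /reflection linearB linearZ /= coord_baseE mulrC.
have hbp : b \in pos_root.
  have /orP[//|hnb] := root_pos_or_neg hb.
  have := coord_pos_ge0 j hnb.
  rewrite linearN /= cbE (negPf hji) mul0r subr0 oppr_ge0 => hle.
  by move: hj; rewrite eq_le hle coord_pos_ge0.
have hcr : cr a = cr b + B (cr a) (Psi D)`_i *: cr (Psi D)`_i.
  by rewrite /b coroot_reflection ?root_neq0 // subrK.
rewrite hcr; have /intrP[z ->] := hint a _ ha hai.
apply: coroot_latticeD; last exact/coroot_latticeZ/coroot_base.
apply: IH => //.
under eq_bigr => k _ do rewrite cbE.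
rewrite sumrB gtrBl (bigD1 i) //= eqxx mul1r big1 ?addr0; last first.
  by move=> k /negPf->; rewrite mul0r.
by rewrite /coroot formZl mulr_gt0 // divr_gt0 // form_gt0 // root_neq0.
Qed.

Lemma coroot_root_lattice a : a \in Delta D -> coroot_lattice (cr a).
Proof.
move=> /root_pos_or_neg/orP[/coroot_pos_lattice//|/coroot_pos_lattice].
by move=> /coroot_latticeN; rewrite corootN opprK.
Qed.

Lemma stabilizes_root (w : 'End(V)) a : stabilizes (Delta D) w ->
  (w a \in Delta D) = (a \in Delta D).
Proof.
move=> /andP[/lker0P hinj /eqP hw]; apply/idP/idP.
  by rewrite -{1}hw => /imfsetP[b /= hb /hinj ->].
by move=> ha; rewrite -hw; apply/imfsetP; exists a.
Qed.

Lemma stabilizes_surj (w : 'End(V)) a : stabilizes (Delta D) w ->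
  a \in Delta D -> exists2 b, b \in Delta D & a = w b.
Proof. by move=> /andP[_ /eqP {1}<-] /imfsetP[b /= hb ->]; exists b. Qed.

Lemma AutDelta_root (w : AutDelta) a : (val w a \in Delta D) = (a \in Delta D).
Proof. exact/stabilizes_root/valP. Qed.

Lemma AutDelta_lattice (w : AutDelta) q :
  coroot_lattice q -> coroot_lattice (val w q).
Proof.
move=> [n ->]; rewrite linear_sum /=.
elim/big_rec: _ => [|i p _ hp]; first exact: coroot_lattice0.
apply: coroot_latticeD => //; rewrite linearZ /=; apply: coroot_latticeZ.
have -> : val w (cr (Psi D)`_i) = cr (val w (Psi D)`_i).
  by rewrite /coroot linearZ /= form_invariant // (valP w).
by apply: coroot_root_lattice; rewrite AutDelta_root base_in_root.
Qed.

Lemma stabilizes1 : stabilizes (Delta D) \1%VF.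
Proof.
apply/andP; split.
  by apply/lker0P => u v; rewrite !id_lfunE.
apply/eqP/fsetP => a; apply/imfsetP/idP => [[b /= hb ->]|ha].
  by rewrite id_lfunE.
by exists a => //; rewrite id_lfunE.
Qed.

Lemma stabilizesM (v w : AutDelta) : stabilizes (Delta D) (val v \o val w)%VF.
Proof.
have /andP[/lker0P kv _] := valP v; have /andP[/lker0P kw _] := valP w.
apply/andP; split.
  by apply/lker0P => x y; rewrite !comp_lfunE => /kv/kw.
apply/eqP/fsetP => a; apply/imfsetP/idP => [[b /= hb ->]|ha].
  by rewrite comp_lfunE !AutDelta_root.
have [b hb ->] := stabilizes_surj (valP v) ha.
have [c hc ->] := stabilizes_surj (valP w) hb.
by exists c => //; rewrite comp_lfunE.
Qed.

Lemma AutDeltaK (w : AutDelta) : cancel ((val w)^-1)%VF (val w).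
Proof.
have /andP[kw _] := valP w => x.
by rewrite lker0_lfunVK.
Qed.

Lemma AutDeltaVK (w : AutDelta) : cancel (val w) ((val w)^-1)%VF.
Proof. by have /andP[kw _] := valP w => x; rewrite lker0_lfunK. Qed.

Lemma stabilizesV (w : AutDelta) : stabilizes (Delta D) ((val w)^-1)%VF.
Proof.
apply/andP; split.
  by apply/lker0P; apply: can_inj (AutDeltaK w).
apply/eqP/fsetP => a; apply/imfsetP/idP => [[b /= hb ->]|ha].
  by rewrite -(AutDelta_root w) AutDeltaK.
by exists (val w a); rewrite ?AutDelta_root // AutDeltaVK.
Qed.

Definition Aut1 : AutDelta :=
  exist (fun w => stabilizes (Delta D) w) _ stabilizes1.
Definition AutM (v w : AutDelta) : AutDelta :=
  exist (fun w => stabilizes (Delta D) w) _ (stabilizesM v w).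
Definition AutV (w : AutDelta) : AutDelta :=
  exist (fun w => stabilizes (Delta D) w) _ (stabilizesV w).

Lemma AutP (v w : AutDelta) : (forall x, val v x = val w x) -> v = w.
Proof. by move=> h; apply: val_inj; apply/lfunP. Qed.

Lemma AutMA : associative AutM.
Proof. by move=> u v w; apply: AutP => x; rewrite /= !comp_lfunE. Qed.
Lemma Aut1M : left_id Aut1 AutM.
Proof. by move=> u; apply: AutP => x; rewrite /= !comp_lfunE id_lfunE. Qed.
Lemma AutM1 : right_id Aut1 AutM.
Proof. by move=> u; apply: AutP => x; rewrite /= !comp_lfunE id_lfunE. Qed.
Lemma AutVM : left_inverse Aut1 AutV AutM.
Proof.
by move=> u; apply: AutP => x; rewrite /= !comp_lfunE id_lfunE AutDeltaVK.
Qed.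
Lemma AutMV : right_inverse Aut1 AutV AutM.
Proof.
by move=> u; apply: AutP => x; rewrite /= !comp_lfunE id_lfunE AutDeltaK.
Qed.

HB.instance Definition _ := isGroup.Build AutDelta AutMA Aut1M AutM1 AutVM AutMV.

(* (w, q) stands for the affine map tau(q) \o w, i.e. v |-> w v + q *)
Definition ext_affine_Weyl : Type := (AutDelta * Qvee)%type.

HB.instance Definition _ := Choice.on ext_affine_Weyl.

Definition Qvee0 : Qvee := SigSub (mem_set coroot_lattice0).

Lemma QveeP (q : Qvee) : coroot_lattice (val q).
Proof. exact: set_valP. Qed.

Definition affM (g h : ext_affine_Weyl) : ext_affine_Weyl :=
  (AutM g.1 h.1,
   SigSub (mem_set (coroot_latticeD (QveeP g.2)
                                    (AutDelta_lattice g.1 (QveeP h.2))))).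
Definition aff1 : ext_affine_Weyl := (Aut1, Qvee0).
Definition affV (g : ext_affine_Weyl) : ext_affine_Weyl :=
  (AutV g.1,
   SigSub (mem_set (coroot_latticeN
                      (AutDelta_lattice (AutV g.1) (QveeP g.2))))).

Lemma affP (g h : ext_affine_Weyl) :
  g.1 = h.1 -> val g.2 = val h.2 -> g = h.
Proof. by case: g h => [w p] [v q] /= -> /val_inj ->. Qed.

Lemma affMA : associative affM.
Proof.
move=> f g h; apply: affP => /=; first exact: AutMA.
by rewrite comp_lfunE linearD addrA.
Qed.
Lemma aff1M : left_id aff1 affM.
Proof.
move=> g; apply: affP => /=; first exact: Aut1M.
by rewrite id_lfunE add0r.
Qed.
Lemma affM1 : right_id aff1 affM.
Proof.
move=> g; apply: affP => /=; first exact: AutM1.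
by rewrite linear0 addr0.
Qed.
Lemma affVM : left_inverse aff1 affV affM.
Proof. by move=> g; apply: affP => /=; [exact: AutVM | rewrite addNr]. Qed.
Lemma affMV : right_inverse aff1 affV affM.
Proof.
move=> g; apply: affP => /=; first exact: AutMV.
by rewrite linearN /= AutDeltaK subrr.
Qed.

HB.instance Definition _ :=
  isGroup.Build ext_affine_Weyl affMA aff1M affM1 affVM affMV.

Definition lin (w : AutDelta) : ext_affine_Weyl := (w, Qvee0).
Definition tau (q : Qvee) : ext_affine_Weyl := (Aut1, q).

(* Vectors indexed by Delta D / {+-1} are functions on pos_root, which is a set
   of representatives; the component x_a at a root a is x (absroot a). *)
Lemma absroot_subproof (a : Delta D) :
  (if val a \in pos_root then val a else - val a) \in pos_root.
Proof.
have /orP := root_pos_or_neg (valP a).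
by case: ifPn => [//|_] [].
Qed.

Definition absroot (a : Delta D) : pos_root := [` absroot_subproof a].

Lemma Aut_root_subproof (w : AutDelta) (a : Delta D) : val w (val a) \in Delta D.
Proof. by rewrite AutDelta_root (valP a). Qed.

Definition Aut_root (w : AutDelta) (a : Delta D) : Delta D :=
  [` Aut_root_subproof w a].

Definition pos_incl (a : pos_root) : Delta D := [` pos_rootP (valP a)].

Definition pos_base (i : 'I_r) : pos_root := [` base_in_pos_root i].

Definition vec_act (T : Type) (w : AutDelta) (x : pos_root -> T) :
    pos_root -> T :=
  fun a : pos_root => x (absroot (Aut_root w^-1%g (pos_incl a))).

Definition inversion_set (w : AutDelta) : {fset V} :=
  pos_root `&` [fset val w^-1%g a | a in neg_root].

Definition t_act (w : AutDelta) (t : pos_root -> R[i]) : pos_root -> R[i] :=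
  fun a : pos_root => let ta := t (absroot (Aut_root w^-1%g (pos_incl a))) in
    if val a \in inversion_set w^-1%g then - ta else ta.

End Notions.

Section Actions.
Variables (G : groupType) (X Y : Type).

Definition is_action (act : G -> X -> X) : Prop :=
  (forall x, act 1%g x = x) /\
  (forall g h x, act (g * h)%g x = act g (act h x)).

Definition fun_act (Z : Type) (aX : G -> X -> X) (aY : G -> Y -> Y) (g : G)
    (f : X -> Y -> Z) : X -> Y -> Z :=
  fun x y => f (aX g^-1%g x) (aY g^-1%g y).

End Actions.

Section Complex.
Variable R : realType.
Implicit Types (x : R) (z s : R[i]).

Definition cexp z : R[i] :=
  (expR (complex.Re z))%:C * (cos (complex.Im z) +i* sin (complex.Im z)).

(* The branch is fixed by log (-1) = (2m + 1) pi i. *)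
Definition clog (m : int) x : R[i] :=
  ln `|x| +i* (if x < 0 then (2 * m + 1)%:~R * pi else 0).

Definition cpow (m : int) x s : R[i] := cexp (s * clog m x).

Definition frac x : R := x - (Num.floor x)%:~R.

(* bernoulli_seq n = [:: B_0; ...; B_n], with B_1 = - 1 / 2 *)
Fixpoint bernoulli_seq (n : nat) : seq R :=
  if n is n'.+1 then
    let s := bernoulli_seq n' in
    rcons s (- (\sum_(j < n) 'C(n.+1, j)%:R * s`_j) / n.+1%:R)
  else [:: 1].

Definition bernoulli (n : nat) : R := (bernoulli_seq n)`_n.

Definition bernoulli_poly (k : nat) : {poly R} :=
  \poly_(i < k.+1) ('C(k, i)%:R * bernoulli (k - i)).

(* The iterated integral over x_a in [0, 1] for a in l of f x, the other
   components of x being kept. *)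
Fixpoint integral01 (I : eqType) (l : seq I) (f : (I -> R) -> R) (x : I -> R) :
    R :=
  if l is a :: l' then
    \int[lebesgue_measure]_(u in `[0, 1]) integral01 l' f [eta x with a |-> u]
  else f x.

End Complex.

Section Meromorphic.
Variables (R : realType) (I : finType).
Implicit Types (t : I -> R[i]) (f g h : (I -> R[i]) -> R[i]).

Definition polydisc t (rho : R) : set (I -> R[i]) :=
  [set u | forall a, `|u a - t a| < rho%:C].

(* partial sums over finite subsets of J, i.e. unconditional convergence *)
Definition has_sum (J : choiceType) (f : J -> R[i]) (l : R[i]) : Prop :=
  partial_sum (f : J -> R[i]^o) @ totally --> (l : R[i]^o).

Definition csum (J : choiceType) (f : J -> R[i]) : R[i] :=
  summability.sum (f : J -> R[i]^o).

Definition analytic_on (U : set (I -> R[i])) f : Prop :=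
  forall t, U t -> exists rho : R, 0 < rho /\
    exists c : {ffun I -> nat} -> R[i], forall u, polydisc t rho u ->
      has_sum (fun k => c k * \prod_a (u a - t a) ^+ k a) (f u).

(* A meromorphic function is represented by a total function whose values on
   its polar set are irrelevant. *)
Definition meromorphic f : Prop :=
  forall t, exists rho : R, exists g h,
    [/\ 0 < rho,
        analytic_on (polydisc t rho) g,
        analytic_on (polydisc t rho) h,
        exists2 u, polydisc t rho u & h u != 0 &
        forall u, polydisc t rho u -> h u != 0 -> f u = g u / h u].

(* agreement on a dense open set *)
Definition mero_eq f g : Prop :=
  forall t (rho : R), 0 < rho -> exists u (sigma : R),
    [/\ 0 < sigma, (polydisc u sigma `<=` polydisc t rho)%classic &
        forall v, polydisc u sigma v -> f v = g v].

End Meromorphic.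

Section ZetaFunctions.
Variables (R : realType) (V : vectType R) (D : root_datum V).

Local Notation Dp := (pos_root D).
Local Notation B := (form D).
Local Notation cr := (coroot (form D)).

Definition S_domain : set (Dp -> R[i]) :=
  [set s | forall a, 1 < complex.Re (s a)].

Definition regular_weight : set V :=
  [set l | weight_lattice D l /\ forall a, a \in Delta D -> B (cr a) l != 0].

Definition S_fun (m : int) (s : Dp -> R[i]) (y : V) : R[i] :=
  csum (fun l : regular_weight =>
    cexp (0 +i* (2 * pi * B y (val l))) *
    \prod_(a : Dp) (cpow m (B (cr (val a)) (val l)) (s a))^-1).

Definition nonsimple : seq Dp := [seq a <- enum {: Dp} | val a \notin Psi D].

Definition P_fun (k : Dp -> nat) (y : V) : R :=
  integral01 nonsimple
    (fun x => (\prod_(a <- nonsimple) (bernoulli_poly R (k a)).[x a]) *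
      \prod_i (bernoulli_poly R (k (pos_base D i))).[
        frac (B y (fweight D i) -
              \sum_(a <- nonsimple) x a * B (cr (val a)) (fweight D i))])
    (fun=> 0).

Definition F_term (y : V) (t : Dp -> R[i]) (k : {ffun Dp -> nat}) : R[i] :=
  (P_fun k y)%:C * \prod_(a : Dp) (t a ^+ k a / (k a)`!%:R).

Definition F_continuation (y : V) (f : (Dp -> R[i]) -> R[i]) : Prop :=
  meromorphic f /\
  forall t, polydisc (fun=> 0) (2 * pi) t -> has_sum (F_term y t) (f t).

(* The continuation is unique only up to mero_eq; xget picks a representative. *)
Definition F_fun (t : Dp -> R[i]) (y : V) : R[i] :=
  xget (fun=> 0) (F_continuation y : set _) t.

End ZetaFunctions.

(* Main.v *)
(* A coroot-lattice vector q pairs integrally with every weight, so translating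
   y by q changes neither the fractional parts in P nor the exponentials in S.
   The power series in t defining F at y and y + q then have the same
   coefficients, hence the same set of meromorphic continuations and the same
   chosen representative, whether or not a continuation exists. *)
Require Import Defs.
From HB Require Import structures.
From mathcomp Require Import all_boot all_order all_algebra.
From mathcomp Require Import finmap.
From mathcomp Require Import all_classical all_reals all_analysis.
From mathcomp Require Import complex.

Set Implicit Arguments.
Unset Strict Implicit.
Unset Printing Implicit Defensive.

Import Order.TTheory GRing.Theory Num.Theory.
Import numFieldNormedType.Exports.

Local Open Scope classical_set_scope.
Local Open Scope ring_scope.
Local Open Scope complex_scope.

Lemma is_actionVK (G : groupType) (X : Type) (act : G -> X -> X) :
  is_action act -> forall g x, act g (act g^-1%g x) = x.
Proof. by move=> [act1 actM] g x; rewrite -actM mulgV act1. Qed.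

(** Inverting the argument reverses products, and precomposition reverses them back. *)
Lemma is_action_fun (G : groupType) (X Y Z : Type)
    (aX : G -> X -> X) (aY : G -> Y -> Y) :
  is_action aX -> is_action aY -> is_action (@fun_act G X Y Z aX aY).
Proof.
move=> [aX1 aXM] [aY1 aYM]; split=> [f|g h f]; apply/funext => x; apply/funext => y.
  by rewrite /fun_act invg1 aX1 aY1.
by rewrite /fun_act invgM aXM aYM.
Qed.

Section RootVectors.
Variables (R : realType) (V : vectType R) (D : root_datum V).

(** Otherwise every coordinate of [a] in [Psi] would be both nonnegative and nonpositive, but 0 is
    not a root. *)
Lemma oppr_pos_root (a : V) : a \in pos_root D -> - a \notin pos_root D.
Proof.
move=> ha; apply/negP => hNa.
suff a0 : a = 0 by have := root_neq0 (pos_rootP ha); rewrite a0 eqxx.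
rewrite [a](sum_coord_base D) big1 // => i _.
suff -> : coord (Psi D) i a = 0 by rewrite scale0r.
apply/eqP; rewrite eq_le (coord_pos_ge0 i ha) andbT -oppr_ge0 -linearN.
exact: coord_pos_ge0.
Qed.

Lemma pos_rootN (a : V) :
  a \in Delta D -> (- a \in pos_root D) = (a \notin pos_root D).
Proof.
move=> ha; apply/idP/idP => [hN|hn].
  by have := oppr_pos_root hN; rewrite opprK.
by have := root_pos_or_neg ha; rewrite (negPf hn).
Qed.

Lemma absroot_pos (a : pos_root D) : absroot (pos_incl a) = a.
Proof. by apply: val_inj; rewrite /= (valP a). Qed.

Definition root_opp (b : Delta D) : Delta D := [` Defs.rootN (valP b)]%fset.

Lemma absroot_opp (b : Delta D) : absroot (root_opp b) = absroot b.
Proof. by apply: val_inj; rewrite /= pos_rootN ?(valP b) // if_neg opprK. Qed.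

Lemma pos_incl_absroot (b : Delta D) :
  pos_incl (absroot b) = if val b \in pos_root D then b else root_opp b.
Proof. by case: ifPn => hb; apply: val_inj; rewrite /= ?hb ?(negPf hb). Qed.

Lemma Aut_root_opp (w : AutDelta D) (b : Delta D) :
  Aut_root w (root_opp b) = root_opp (Aut_root w b).
Proof. by apply: val_inj; rewrite /= linearN. Qed.

Lemma Aut_root1 (b : Delta D) : Aut_root 1%g b = b.
Proof. by apply: val_inj; rewrite /= id_lfunE. Qed.

Lemma Aut_rootM (v w : AutDelta D) (b : Delta D) :
  Aut_root (v * w)%g b = Aut_root v (Aut_root w b).
Proof. by apply: val_inj; rewrite /= comp_lfunE. Qed.

(** Choosing a positive representative between two automorphisms changes a root at most by a sign,
    which commutes with linear maps and is erased by [absroot]. *)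
Lemma is_action_vec_act (T : Type) : is_action (@vec_act R V D T).
Proof.
split=> [x|v w x]; apply/funext => a; rewrite /vec_act.
  by rewrite invg1 Aut_root1 absroot_pos.
rewrite invgM Aut_rootM pos_incl_absroot; case: ifP => _ //.
by rewrite Aut_root_opp absroot_opp.
Qed.

Definition odd_ext (t : pos_root D -> R[i]) (b : Delta D) : R[i] :=
  if val b \in pos_root D then t (absroot b) else - t (absroot b).

Lemma odd_ext_opp t b : odd_ext t (root_opp b) = - odd_ext t b.
Proof.
rewrite /odd_ext absroot_opp /= pos_rootN ?(valP b) //.
by case: (_ \in _); rewrite /= ?opprK.
Qed.

(** This set consists of the positive roots in the image under [w] of the negative roots, so
    membership is tested by applying the inverse of [w]. *)
Lemma inversion_setV (w : AutDelta D) (a : pos_root D) :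
  (val a \in inversion_set w^-1%g) =
  (val (Aut_root w^-1%g (pos_incl a)) \notin pos_root D).
Proof.
rewrite /inversion_set in_fsetI (valP a) invgK /=.
rewrite -pos_rootN; last by rewrite -(AutDelta_root w) AutDeltaK pos_rootP ?(valP a).
apply/imfsetP/idP => [[b /= /imfsetP[c /= hc ->] ->]|h].
  by rewrite AutDeltaVK opprK.
exists (((val w)^-1)%VF (val a)); last by rewrite /= AutDeltaK.
(* [neg_root] is itself an image under negation, hence a positive root is supplied here. *)
by apply/imfsetP; exists (- ((val w)^-1)%VF (val a)); rewrite ?opprK.
Qed.

Lemma t_act_odd_ext (w : AutDelta D) t a :
  t_act w t a = odd_ext t (Aut_root w^-1%g (pos_incl a)).
Proof. by rewrite /t_act inversion_setV /odd_ext if_neg. Qed.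

(** Both sides are odd in [b], so the case of positive [b] decides; this lets [t_act] be
    iterated. *)
Lemma odd_ext_t_act (w : AutDelta D) t b :
  odd_ext (t_act w t) b = odd_ext t (Aut_root w^-1%g b).
Proof.
rewrite {1}/odd_ext !t_act_odd_ext pos_incl_absroot; case: (val b \in _) => //.
by rewrite Aut_root_opp odd_ext_opp opprK.
Qed.

(* The signs in the action on t form a cocycle: extended to all roots by
   t_{-a} = - t_a, the action is the sign-free t_a |-> t_{w^-1 a}. *)
Lemma is_action_t_act : is_action (@t_act R V D).
Proof.
split=> [t|v w t]; apply/funext => a; rewrite !t_act_odd_ext.
  by rewrite invg1 Aut_root1 /odd_ext /= (valP a) absroot_pos.
by rewrite odd_ext_t_act invgM Aut_rootM.
Qed.

(** Taking the linear part is a group homomorphism whose kernel is the translations. *)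
Lemma is_action_lin_part (X : Type) (act : AutDelta D -> X -> X) :
  is_action act -> is_action (fun g : ext_affine_Weyl D => act g.1).
Proof. by move=> [act1 actM]; split=> [x|g h x]; rewrite -?actM // -[RHS]act1. Qed.

Definition affine_act (g : ext_affine_Weyl D) (y : V) : V :=
  val g.1 y + val g.2.

Lemma is_action_affine_act : is_action affine_act.
Proof.
split=> [y|g h y]; rewrite /affine_act /=; first by rewrite id_lfunE addr0.
by rewrite comp_lfunE linearD /= [in RHS]addrAC addrA addrAC.
Qed.

End RootVectors.

Section Periodicity.
Variable R : realType.

Lemma cexp_periodic (x : R) (z : int) :
  cexp (0 +i* (x + 2 * pi * z%:~R)) = cexp (0 +i* x).
Proof.
have cexpDn (u : R) n : cexp (0 +i* (u + 2 * pi * n%:R)) = cexp (0 +i* u).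
  rewrite /cexp /= !mulr_natr [2 * pi]mulr_natl.
  by rewrite (periodicn (@cosD2pi R)) (periodicn (@sinD2pi R)).
case: z => n; first exact: cexpDn.
(* [Negz n] is -(n+1), so shifting forward by n+1 periods returns to [x]. *)
by rewrite -(cexpDn _ n.+1) NegzE mulrNz mulrN subrK.
Qed.

Lemma frac_periodic (x : R) (z : int) : Defs.frac (x + z%:~R) = Defs.frac x.
Proof.
rewrite /Defs.frac floorDrz ?intr_int // intrKfloor intrD.
by rewrite opprD addrACA subrr addr0.
Qed.

Variables (V : vectType R) (D : root_datum V).

(** By duality of simple coroots and fundamental weights, the pairing extracts the [i]-th
    coefficient of [q]. *)
Lemma form_lattice_weight (q : V) i : coroot_lattice D q ->
  exists z : int, Defs.form D q (fweight D i) = z%:~R.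
Proof.
move=> [n ->]; exists (n i).
rewrite Defs.formC linear_sumr (bigD1 i) //= big1 ?addr0 => [|j ji].
  by rewrite Defs.formZr Defs.formC fweightP eqxx mulr1.
by rewrite Defs.formZr Defs.formC fweightP [_ == _](negPf ji) mulr0.
Qed.

(** The shift is by [- q] since [fun_act] feeds the inverse group element to the arguments. *)
Lemma P_fun_periodic (k : pos_root D -> nat) (y q : V) :
  coroot_lattice D q -> P_fun k (y - q) = P_fun k y.
Proof.
move=> hq; rewrite /P_fun; congr (integral01 _ _ _).
apply/funext => x; congr (_ * _); apply: eq_bigr => i _; congr (_.[_]).
have [z hz] := form_lattice_weight i hq.
rewrite linearBl /= hz addrAC -mulrNz; exact: frac_periodic.
Qed.

Lemma F_fun_periodic (t : pos_root D -> R[i]) (y q : V) :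
  coroot_lattice D q -> F_fun t (y - q) = F_fun t y.
Proof.
move=> hq; rewrite /F_fun; congr (xget _ _ _); rewrite /F_continuation.
(* The vector [y] enters the continuation predicate only through the terms of the series. *)
suff -> : @F_term R V D (y - q) = @F_term R V D y by [].
apply/funext => u; apply/funext => k.
by rewrite /F_term P_fun_periodic.
Qed.

Lemma S_fun_periodic m (s : pos_root D -> R[i]) (y q : V) :
  coroot_lattice D q -> S_fun m s (y - q) = S_fun m s y.
Proof.
move=> hq; rewrite /S_fun; congr csum; apply/funext => l; congr (_ * _).
have [[n hn] _] := set_valP l.
(* Integrality passes from the fundamental weights to the whole weight lattice by linearity. *)
have [z hz] : exists z : int, Defs.form D q (val l) = z%:~R.
  apply/intrP; rewrite hn linear_sumr /=; apply: rpred_sum => i _.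
  have [z hz] := form_lattice_weight i hq.
  by rewrite Defs.formZr hz rpredM ?intr_int.
by rewrite linearBl /= hz mulrBr -mulrN -mulrNz cexp_periodic.
Qed.

End Periodicity.

Theorem theorem5p8 (R : realType) (V : vectType R) (D : root_datum V) (m : int) :
  exists (act_s : ext_affine_Weyl D ->
            (pos_root D -> R[i]) -> (pos_root D -> R[i]))
         (act_t : ext_affine_Weyl D ->
            (pos_root D -> R[i]) -> (pos_root D -> R[i]))
         (act_k : ext_affine_Weyl D ->
            (pos_root D -> nat) -> (pos_root D -> nat))
         (act_y : ext_affine_Weyl D -> V -> V),
    [/\ [/\ is_action act_s, is_action act_t, is_action act_k & is_action act_y],
        forall Z : Type,
          [/\ is_action (@fun_act _ _ _ Z act_s act_y),
              is_action (@fun_act _ _ _ Z act_t act_y) &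
              is_action (@fun_act _ _ _ Z act_k act_y)],
        forall w : AutDelta D,
          [/\ forall s, act_s (lin w) s = vec_act w s,
              forall t, act_t (lin w) t = t_act w t,
              forall k, act_k (lin w) k = vec_act w k &
              forall y, act_y (lin w) y = val w y],
        forall q : Qvee D,
          [/\ forall s, act_s (tau q) s = s,
              forall t, act_t (tau q) t = t,
              forall k, act_k (tau q) k = k &
              forall y, act_y (tau q) y = y + val q] &
        forall q : Qvee D,
          [/\ forall s y, S_domain s ->
                fun_act act_s act_y (tau q) (@S_fun R V D m) s y = S_fun m s y,
              forall y,
                mero_eq (fun t =>
                           fun_act act_t act_y (tau q) (@F_fun R V D) t y)
                        (fun t => F_fun t y) &
              forall k y,
                fun_act act_k act_y (tau q) (@P_fun R V D) k y = P_fun k y]].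
Proof.
have As := is_action_lin_part (@is_action_vec_act R V D R[i]).
have At := is_action_lin_part (@is_action_t_act R V D).
have Ak := is_action_lin_part (@is_action_vec_act R V D nat).
have Ay := @is_action_affine_act R V D.
(* Translations are made trivial on [s], [t], [k] by acting through the linear part; on [y] the
   group acts by affine maps. *)
exists (fun g => vec_act g.1), (fun g => @t_act R V D g.1),
  (fun g => vec_act g.1), (@affine_act R V D).
have tauVy (q : Qvee D) y : affine_act (tau q)^-1%g y = y - val q.
  (* Writing [y] as [tau q] applied to its preimage and cancelling [q] avoids unfolding the
     inverse. *)
  rewrite -[in RHS](is_actionVK Ay (tau q) y).
  by rewrite {2}/affine_act /= id_lfunE addrK.
have vec1 T (x : pos_root D -> T) : vec_act 1%g x = x.
  by case: (@is_action_vec_act R V D T).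
have t1 t : t_act (1%g : AutDelta D) t = t by case: (@is_action_t_act R V D).
have tauV1 (q : Qvee D) : ((tau q)^-1%g : ext_affine_Weyl D).1 = 1%g by rewrite -[RHS]invg1.
split=> //.
- by move=> Z; split; apply: is_action_fun.
- by move=> w; split=> // y; rewrite /affine_act addr0.
- by move=> q; split=> [s|t|k|y]; rewrite ?vec1 ?t1 // /affine_act id_lfunE.
move=> q; have hq := QveeP q; split=> [s y _|y|k y].
- by rewrite /fun_act tauV1 vec1 tauVy S_fun_periodic.
(* The two functions agree at every point, so the given polydisc itself serves. *)
- move=> t rho rho0; exists t, rho; split=> // v _.
  by rewrite /fun_act tauV1 t1 tauVy F_fun_periodic.
- by rewrite /fun_act tauV1 vec1 tauVy P_fun_periodic.
Qed.
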